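(* Let $L,M$ be locales and let $f\colon L\to M$ be a map preserving arbitrary meets. Define $f_{\mathfrak o}^{\Rightarrow}\colon \mathfrak o L\to\mathfrak o M$ by $f_{\mathfrak o}^{\Rightarrow}(\mathfrak o(a))=\mathrm{int}(f[\mathfrak o(a)])$ and $f_{\mathfrak o}^{\leftarrow}\colon \mathfrak o M\to\mathfrak o L$ by $f_{\mathfrak o}^{\leftarrow}(\mathfrak o(b))=\mathrm{int}(f^{-1}[\mathfrak o(b)])$. Then $(f_{\mathfrak o}^{\Rightarrow},f_{\mathfrak o}^{\leftarrow})$ is an adjoint pair, i.e. $f_{\mathfrak o}^{\Rightarrow}\dashv f_{\mathfrak o}^{\leftarrow}$, if and only if $f$ is open.
   Context: A locale (= frame) is a complete lattice $L$ with $(\bigvee A)\wedge b=\bigvee\{a\wedge b\mid a\in A\}$ for all $A\subseteq L$, $b\in L$; it has a Heyting operation $\to$ with $a\wedge b\le c\iff a\le b\to c$. For $a\in L$, $\mathfrak o(a)=\{x\in L\mid a\to x=x\}$ is the open sublocale associated with $a$; $\mathfrak o L=\{\mathfrak o(a)\mid a\in L\}$, ordered by inclusion. For any subset $S\subseteq L$, $\mathrm{int}\,S=\mathfrak o(\bigvee\{a\in L\mid \mathfrak o(a)\subseteq S\})$. A map $f\colon L\to M$ between locales (not necessarily localic) is open if for every $a\in L$ the set-theoretic image $f[\mathfrak o(a)]$ is an open sublocale of $M$, i.e. equals $\mathfrak o(b)$ for some $b\in M$. For posets $X,Y$, a pair $(g,h)$ of order-preserving maps $g\colon X\to Y$, $h\colon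 Y\to X$ is an adjoint pair, $g\dashv h$, if $g(x)\le y\iff x\le h(y)$ for all $x\in X$, $y\in Y$. *)

(* Defs.v *)
From HB Require Import structures.
From mathcomp Require Import all_boot all_order.
From mathcomp Require Import boolp classical_sets.

Set Implicit Arguments.
Unset Strict Implicit.
Unset Printing Implicit Defensive.

Import Order.TTheory.
Local Open Scope classical_set_scope.
Local Open Scope order_scope.

(* [supremums A] is the set of least upper bounds of [A]. *)
HB.mixin Record TBLattice_isComplete d L of Order.TBLattice d L := {
  bigjoin : set L -> L;
  bigjoin_supremums : forall A : set L, supremums A (bigjoin A)
}.

#[short(type="completeLatticeType")]
HB.structure Definition CompleteLattice d :=
  { L of TBLattice_isComplete d L & Order.TBLattice d L }.

HB.mixin Record CompleteLattice_isFrame d L of CompleteLattice d L := {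
  bigjoin_meetl : forall (A : set L) (b : L),
    bigjoin A `&` b = bigjoin [set a `&` b | a in A]
}.

#[short(type="frameType")]
HB.structure Definition Frame d :=
  { L of CompleteLattice_isFrame d L & CompleteLattice d L }.

Section CompleteLatticeTheory.
Context {d : Order.disp_t} {L : completeLatticeType d}.
Implicit Types (A : set L) (x : L).

Definition bigmeet A : L := bigjoin (lbound A).

Lemma bigjoin_ub A x : A x -> x <= bigjoin A.
Proof. by have [ubA _] := bigjoin_supremums A; exact: ubA. Qed.

Lemma bigjoin_le A x : ubound A x -> bigjoin A <= x.
Proof. by have [_ lubA] := bigjoin_supremums A; exact: lubA. Qed.

Lemma bigmeet_infimums A : infimums A (bigmeet A).
Proof.
split=> [x Ax|x lbx]; last exact: bigjoin_ub.
by apply: bigjoin_le => y; exact.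
Qed.

End CompleteLatticeTheory.

Section HeytingImplication.
Context {d : Order.disp_t} {L : frameType d}.
Implicit Types a b c : L.

Definition himp a b : L := bigjoin [set x | x `&` a <= b].

Lemma himpP a b c : (a `&` b <= c) = (a <= himp b c).
Proof.
apply/idP/idP => [abc|abc]; first exact: bigjoin_ub.
rewrite (le_trans (leI2 abc (lexx b)))// /himp bigjoin_meetl.
by apply: bigjoin_le => _ [x xbc <-].
Qed.

End HeytingImplication.

Section OpenSublocales.
Context {d : Order.disp_t} {L : frameType d}.

Definition open_subloc (a : L) : set L := [set x | himp a x = x].

Definition is_open_subloc (S : set L) : Prop := exists a, S = open_subloc a.

End OpenSublocales.

(* The poset of open sublocales of [L]. It carries the order induced by the
   order of [set L], which is inclusion; see [le_opens]. *)
Record opens d (L : frameType d) := Opens {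
  opens_set :> set L;
  _ : `[< is_open_subloc opens_set >]
}.

HB.instance Definition _ d (L : frameType d) :=
  [isSub for @opens_set d L].
HB.instance Definition _ d (L : frameType d) :=
  [Choice of opens L by <:].
HB.instance Definition _ d (L : frameType d) :=
  [SubChoice_isSubPOrder of opens L by <: with set_display].

Section Opens.
Context {d : Order.disp_t} {L : frameType d}.

Lemma le_opens (U V : opens L) : (U <= V) <-> (U `<=` V).
Proof. by rewrite -subsetEset Order.le_val. Qed.

Lemma opensP (U : opens L) : exists a, U = open_subloc a :> set L.
Proof. by case: U => S /= /asboolP. Qed.

Lemma open_subloc_is_open (a : L) : `[< is_open_subloc (open_subloc a) >].
Proof. by apply/asboolP; exists a. Qed.

Definition open_of (a : L) : opens L := Opens (open_subloc_is_open a).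

(* [S] is an arbitrary subset: [opens_int S `<=` S] may fail, since the open
   sublocale of a join is the closure under meets of the union. *)
Definition opens_int (S : set L) : opens L :=
  open_of (bigjoin [set a | open_subloc a `<=` S]).

End Opens.

Section Maps.
Context {d d' : Order.disp_t} {L : frameType d} {M : frameType d'}.
Variable f : L -> M.

Definition preserves_meets : Prop :=
  forall A : set L, f (bigmeet A) = bigmeet (f @` A).

Definition open_map : Prop :=
  forall a : L, is_open_subloc (f @` open_subloc a).

Definition open_image (U : opens L) : opens M := opens_int (f @` U).

Definition open_preimage (V : opens M) : opens L := opens_int (f @^-1` V).

End Maps.

Definition adjoint_pair d d' (X : porderType d) (Y : porderType d')
    (g : X -> Y) (h : Y -> X) : Prop :=
  [/\ {homo g : x x' / x <= x'}, {homo h : y y' / y <= y'}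
    & forall x y, g x <= y <-> x <= h y].

(* Main.v *)
Require Import Defs.
From mathcomp Require Import all_boot all_order.
From mathcomp Require Import boolp classical_sets.

(** Since [f] preserves meets, both [f @` U] and [f @^-1` V] are closed under
    meets, and for such a set [S] the interior is the largest open sublocale
    contained in [S]. Hence [U <= open_preimage f V] always means
    [f @` U `<=` V], which is the adjunction condition as soon as
    [open_image f U] is [f @` U]. Conversely, the adjunction applied to
    [V := open_image f U] gives [f @` U `<=` open_image f U]. *)

Set Implicit Arguments.
Unset Strict Implicit.
Unset Printing Implicit Defensive.

Import Order.TTheory.
Local Open Scope classical_set_scope.
Local Open Scope order_scope.

Section MeetClosed.
Context {d : Order.disp_t} {L : completeLatticeType d}.

(** The family [A] may be empty, so such an [S] contains the top element. *)
Definition meet_closed (S : set L) : Prop :=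
  forall A : set L, A `<=` S -> S (bigmeet A).

Lemma bigmeet_lb (A : set L) x : A x -> bigmeet A <= x.
Proof. by have [lbA _] := bigmeet_infimums A; exact: lbA. Qed.

Lemma bigmeet_ge (A : set L) x : lbound A x -> x <= bigmeet A.
Proof. by have [_ glbA] := bigmeet_infimums A; exact: glbA. Qed.

End MeetClosed.

Section Interior.
Context {d : Order.disp_t} {L : frameType d}.
Implicit Types (a b x : L) (S : set L) (U : opens L).

Lemma le_himp a x : x <= himp a x.
Proof. by rewrite -himpP leIl. Qed.

Lemma open_sublocE a x : open_subloc a x <-> himp a x <= x.
Proof.
split=> [ax|ax]; first by rewrite [X in X <= _]ax.
by apply/eqP; rewrite eq_le ax le_himp.
Qed.

(** Modus ponens used twice: [a] can be met twice at no cost. *)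
Lemma open_subloc_himp a x : open_subloc a (himp a x).
Proof.
apply/open_sublocE.
have le1 : himp a (himp a x) `&` a <= himp a x by rewrite himpP.
rewrite -himpP; have : himp a x `&` a <= x by rewrite himpP.
by apply: le_trans; rewrite lexI le1 leIr.
Qed.

(** Implication is antitone in its first argument, so [himp b x <= himp a x <= x]. *)
Lemma open_subloc_sub a b : a <= b -> open_subloc a `<=` open_subloc b.
Proof.
move=> ab x /open_sublocE ax; apply/open_sublocE; apply: le_trans ax.
have bx : himp b x `&` b <= x by rewrite himpP.
by rewrite -himpP (le_trans (leI2 (lexx _) ab)).
Qed.

(** Implication is monotone in its second argument, so [himp a (bigmeet A)] lies below
    [himp a x <= x] for each [x] in [A]. *)
Lemma open_subloc_meet_closed a : meet_closed (open_subloc a).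
Proof.
move=> A Aa; apply/open_sublocE/bigmeet_ge => x Ax.
have /open_sublocE := Aa _ Ax; apply: le_trans.
have mx : himp a (bigmeet A) `&` a <= bigmeet A by rewrite himpP.
by rewrite -himpP (le_trans mx)// bigmeet_lb.
Qed.

Lemma opens_meet_closed U : meet_closed U.
Proof. by have [a ->] := opensP U; exact: open_subloc_meet_closed. Qed.

Lemma sub_opens_int S U : U `<=` S -> U <= opens_int S.
Proof.
have [a Ua] := opensP U; rewrite le_opens Ua => aS.
by apply: open_subloc_sub; exact: bigjoin_ub.
Qed.

(* [x = (\bigvee_i a_i) -> x] is the meet of the [a_i -> x], each of which lies
   in [open_subloc a_i]. *)
Lemma opens_int_sub S : meet_closed S -> opens_int S `<=` S.
Proof.
move=> SM x /=; set A := [set a | _] => /open_sublocE jx.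
suff -> : x = bigmeet [set himp a x | a in A].
  by apply: SM => _ [a aS <-]; apply: aS; exact: open_subloc_himp.
apply/eqP; rewrite eq_le; apply/andP; split.
  by apply: bigmeet_ge => _ [a _ <-]; exact: le_himp.
apply: le_trans jx; rewrite -himpP meetC bigjoin_meetl.
apply: bigjoin_le => _ [a Aa <-]; rewrite meetC himpP.
by apply: bigmeet_lb; exists a.
Qed.

Lemma le_opens_int S U : meet_closed S -> U <= opens_int S <-> U `<=` S.
Proof.
move=> SM; split; last exact: sub_opens_int.
by rewrite le_opens => /subset_trans; apply; exact: opens_int_sub.
Qed.

Lemma opens_int_id U : opens_int U = U.
Proof.
apply/eqP; rewrite eq_le sub_opens_int// andbT; apply/le_opens.
by apply: opens_int_sub; exact: opens_meet_closed.
Qed.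

End Interior.

Section MeetPreservingMap.
Context {d d' : Order.disp_t} {L : frameType d} {M : frameType d'}.
Variable f : L -> M.
Hypothesis f_meets : preserves_meets f.

Lemma image_meet_closed (S : set L) : meet_closed S -> meet_closed (f @` S).
Proof.
move=> SM B BS; exists (bigmeet (S `&` f @^-1` B)); first by apply: SM => x [].
rewrite f_meets; congr bigmeet; apply/seteqP; split=> [_ [x [_ Bx] <-]//|y By].
by have [x Sx xy] := BS _ By; exists x; rewrite //= xy.
Qed.

Lemma preimage_meet_closed (S : set M) :
  meet_closed S -> meet_closed (f @^-1` S).
Proof. by move=> SM A AS; rewrite /= f_meets; apply: SM => _ [x /AS Sx <-]. Qed.

Lemma open_image_sub (U : opens L) : open_image f U `<=` f @` U.
Proof.
apply: opens_int_sub; apply: image_meet_closed; exact: opens_meet_closed.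
Qed.

Lemma le_open_preimage (U : opens L) (V : opens M) :
  U <= open_preimage f V <-> f @` U `<=` V.
Proof.
rewrite image_subP; apply: le_opens_int; apply: preimage_meet_closed.
exact: opens_meet_closed.
Qed.

End MeetPreservingMap.

Lemma open_image_id d d' (L : frameType d) (M : frameType d') (f : L -> M)
    (U : opens L) : open_map f -> open_image f U = f @` U :> set M.
Proof.
have [a Ua] := opensP U => /(_ a) [b fab].
have fU : f @` U = open_of b by rewrite Ua fab.
by rewrite /open_image fU opens_int_id.
Qed.

Theorem theorem3p3p2 (d d' : Order.disp_t) (L : frameType d) (M : frameType d')
    (f : L -> M) (f_meets : preserves_meets f) :
  adjoint_pair (open_image f) (open_preimage f) <-> open_map f.
Proof.
split=> [[_ _ adj] a|f_open].
  have [b fab] := opensP (open_image f (open_of a)); exists b; rewrite -fab.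
  apply/seteqP; split; last exact: open_image_sub.
  (* The unit of the adjunction, obtained from reflexivity at [open_image f (open_of a)]. *)
  exact/(le_open_preimage f_meets (open_of a))/adj.
split=> [U U' /le_opens UU'|V V' /le_opens VV'|U V].
- by apply/le_opens; rewrite !open_image_id//; exact: image_subset.
- apply/(le_open_preimage f_meets); apply: subset_trans VV'.
  exact/(le_open_preimage f_meets).
- by rewrite (le_open_preimage f_meets) le_opens open_image_id.
Qed.
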